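(* Let $G$ be a symmetry group of the discrete Lagrange--Poincaré system $\mathcal M=(E,L_d,\mathcal P)$ over a fiber bundle $\phi:E\to M$, let $\mathcal A_d$ be a discrete connection on the principal $G$-bundle $\pi^{M,G}:M\to M/G$, and let $\mathcal M/(G,\mathcal A_d)$ be the corresponding reduced system. Let $(v_\cdot,r_\cdot)=((v_0,r_1),\ldots,(v_{N-1},r_N))$, $N\ge 2$, be a trajectory of $\mathcal M/(G,\mathcal A_d)$ and let $(\tilde\epsilon_0,\tilde m_1)\in C'(E)$ be such that $\Upsilon_{\mathcal A_d}(\tilde\epsilon_0,\tilde m_1)=(v_0,r_1)$. Then there exists a unique trajectory $(\epsilon_\cdot,m_\cdot)$ of $\mathcal M$ such that $(\epsilon_0,m_1)=(\tilde\epsilon_0,\tilde m_1)$ and $\Upsilon_{\mathcal A_d}(\epsilon_k,m_{k+1})=(v_k,r_{k+1})$ for all $k$.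
   Context: Notation. $p_j$ is the projection of a Cartesian product on its $j$-th factor; $D_j$ is the restriction of the differential to the $j$-th factor of a product. A fiber bundle $(E,M,\phi,F)$ is a smooth map $\phi:E\to M$ of manifolds such that every $m\in M$ has an open neighborhood $U$ and a diffeomorphism $\Phi_U:\phi^{-1}(U)\to U\times F$ with $p_1\circ\Phi_U=\phi$ (a trivializing chart). For a left action $l^X$ of a Lie group $G$ on $X$, $\pi^{X,G}:X\to X/G$ is the quotient map. A principal $G$-bundle is a surjective submersion whose total space carries a smooth free left $G$-action with orbits equal to the fibers. Group action on a fiber bundle. $G$ acts on $(E,M,\phi,F)$ if there are smooth free left actions $l^E,l^M$ and a smooth right action $r^F$ on $F$ such that (1) $\pi^{M,G}:M\to M/G$ is a principal $G$-bundle; (2) $\phi$ is $G$-equivariant; (3) every $m\in M$ lies in a $G$-invariant open $U$ with a trivializing chart $\Phi_U$ that is $G$-equivariant for $l^{U\times F}_g(m,f)=(l^M_g(m),r^F_{g^{-1}}(f))$ on $U\times F$. DLPS. For a fiber bundle $\phi:E\to M$ put $C'(E)=E\times M$ and $C''(E)=\{((\epsilon_0,m_1),(\epsilon_1,m_2))\in C'(E)^2: m_1=\phi(\epsilon_1)\}$. A discrete Lagrange--Poincaré system (DLPS) over $E$ is $\mathcal M=(E,L_d,\mathcal P)$ with $L_d:C'(E)\to\mathbb R$ smooth and $\mathcal P$ an infinitesimal variation chaining map: a smooth family of linear maps $\mathcal P((\epsilon_0,m_1),(\epsilon_1,m_2)):T_{\epsilon_1}E\to\ker d\phi(\epsilon_0)\subset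 T_{\epsilon_0}E$ indexed by $C''(E)$ (a vector bundle homomorphism). Trajectories. A discrete path in $C'(E)$ is $((\epsilon_0,m_1),\ldots,(\epsilon_{N-1},m_N))$ with consecutive pairs in $C''(E)$. An infinitesimal variation with fixed endpoints on it is a family $(\delta\epsilon_k,\delta m_{k+1})\in T_{(\epsilon_k,m_{k+1})}C'(E)$, $k=0,\dots,N-1$, with $\delta m_k=d\phi(\epsilon_k)(\delta\epsilon_k)$ for $1\le k\le N-1$, $\delta m_N=0$, and for which there are arbitrary vectors $\widetilde{\delta\epsilon_k}\in T_{\epsilon_k}E$ ($1\le k\le N-1$) with $\delta\epsilon_{N-1}=\widetilde{\delta\epsilon_{N-1}}$, $\delta\epsilon_k=\widetilde{\delta\epsilon_k}+\mathcal P((\epsilon_k,m_{k+1}),(\epsilon_{k+1},m_{k+2}))(\widetilde{\delta\epsilon_{k+1}})$ for $1\le k\le N-2$, and $\delta\epsilon_0=\mathcal P((\epsilon_0,m_1),(\epsilon_1,m_2))(\widetilde{\delta\epsilon_1})$. With $S_d(\epsilon_\cdot,m_\cdot)=\sum_{k=0}^{N-1}L_d(\epsilon_k,m_{k+1})$, the path is a trajectory if $dS_d(\epsilon_\cdot,m_\cdot)(\delta\epsilon_\cdot,\delta m_\cdot)=0$ for all infinitesimal variations with fixed endpoints. Symmetry group. $G$ is a symmetry group of $\mathcal M=(E,L_d,\mathcal P)$ if $G$ acts on the fiber bundle $E$, $L_d$ is invariant under $l^{C'(E)}_g(\epsilon_0,m_1)=(l^E_g(\epsilon_0),l^M_g(m_1))$,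 and $\mathcal P$ is equivariant: $\mathcal P(l^{C'(E)}_g(\epsilon_0,m_1),l^{C'(E)}_g(\epsilon_1,m_2))(dl^E_g(\delta\epsilon_1))=dl^E_g(\mathcal P((\epsilon_0,m_1),(\epsilon_1,m_2))(\delta\epsilon_1))$ for all $g\in G$. Discrete connections. A discrete connection $\mathcal A_d$ on a principal $G$-bundle $\pi^{M,G}:M\to M/G$ is given by a submanifold $Hor\subset M\times M$, invariant under the diagonal $G$-action and containing the diagonal, such that $(id_M\times\pi^{M,G})|_{Hor}:Hor\to M\times(M/G)$ is an injective local diffeomorphism. Convention: it is treated as globally defined (this map is onto), so that for all $m_0,m_1$ there is a unique $g=:\mathcal A_d(m_0,m_1)\in G$ with $(m_0,l^M_{g^{-1}}(m_1))\in Hor$; the function $\mathcal A_d:M\times M\to G$ is smooth. Reduction. $\tilde G_E:=(E\times G)/G$ is the quotient by $g\cdot(\epsilon,w)=(l^E_g(\epsilon),gwg^{-1})$; it is a fiber bundle over $M/G$ with projection $p^{M/G}(\pi^{E\times G,G}(\epsilon,w))=\pi^{M,G}(\phi(\epsilon))$ and fiber $F\times G$, so $C'(\tilde G_E)=\tilde G_E\times(M/G)$. Given $\mathcal A_d$, let $\Upsilon_{\mathcal A_d}:C'(E)\to C'(\tilde G_E)$, $\Upsilon_{\mathcal A_d}(\epsilon,m)=(\pi^{E\times G,G}(\epsilon,\mathcal A_d(\phi(\epsilon),m)),\pi^{M,G}(m))$. The reduced DLPS $\mathcal M/(G,\mathcal A_d)=(\tilde G_E,\check L_d,\check{\mathcal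 P})$ is defined by $\check L_d\circ\Upsilon_{\mathcal A_d}=L_d$ and $\check{\mathcal P}((v_0,r_1),(v_1,r_2))(\delta v_1)=D_1(p_1\circ\Upsilon_{\mathcal A_d})(\epsilon_0,m_1)(\mathcal P((\epsilon_0,m_1),(\epsilon_1,m_2))(\delta\epsilon_1))+D_2(p_1\circ\Upsilon_{\mathcal A_d})(\epsilon_0,m_1)(d\phi(\epsilon_1)(\delta\epsilon_1))$, where $((\epsilon_0,m_1),(\epsilon_1,m_2))\in C''(E)$ is any element with $\Upsilon_{\mathcal A_d}(\epsilon_0,m_1)=(v_0,r_1)$, $\Upsilon_{\mathcal A_d}(\epsilon_1,m_2)=(v_1,r_2)$ and $\delta\epsilon_1$ is the unique vector with $D_1(p_1\circ\Upsilon_{\mathcal A_d})(\epsilon_1,m_2)(\delta\epsilon_1)=\delta v_1$ (this is well defined). *)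

(* Defs.v *)
From HB Require Import structures.
From mathcomp Require Import all_boot all_order all_algebra.
From mathcomp Require Import all_classical all_reals all_analysis.

Set Implicit Arguments.
Unset Strict Implicit.
Unset Printing Implicit Defensive.

Import Order.TTheory GRing.Theory Num.Theory.
Import numFieldNormedType.Exports.

Local Open Scope classical_set_scope.
Local Open Scope ring_scope.

Definition finite_dim (R : realType) (V : normedModType R) : Prop :=
  exists (n : nat) (f : {linear V -> 'rV[R]_n}), bijective f.

(* On an open set of a finite-dimensional space, f is C^(k+1) iff it is
   differentiable and all its directional derivatives are C^k. *)
Fixpoint Ck (R : realType) (V W : normedModType R) (k : nat) (A : set V)
    (f : V -> W) : Prop :=
  match k with
  | 0 => forall x, A x -> {for x, continuous f}
  | k'.+1 => (forall x, A x -> differentiable f x) /\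
             (forall v : V, Ck k' A (fun x => 'D_v f x))
  end.

Definition Cinfty (R : realType) (V W : normedModType R) (A : set V)
    (f : V -> W) : Prop := forall k, Ck k A f.

Lemma Ck_subset (R : realType) (V W : normedModType R) k (A B : set V)
    (f : V -> W) : B `<=` A -> Ck k A f -> Ck k B f.
Proof.
move=> BA; elim: k f => [|k IH] f /=; first by move=> h x /BA /h.
by move=> [h1 h2]; split=> [x /BA /h1 //|v]; exact: IH.
Qed.

Lemma near_eq_differentiable (R : realType) (V W : normedModType R)
    (f g : V -> W) (x : V) :
  (\forall y \near x, f y = g y) -> differentiable f x -> differentiable g x.
Proof.
move=> fg df; have z0 : \forall y \near x, (g - f) y = 0.
  by apply: filterS fg => y e; rewrite -[(g - f) y]/(g y - f y) e subrr.
have -> : g = f + (g - f) by rewrite addrC subrK.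
apply: differentiableD => //; apply/diff_locallyP.
have cL : continuous (\0 : V -> W) by move=> ?; exact: cst_continuous.
have oL : (g - f) \o shift x = cst ((g - f) x) + (\0 : V -> W) +o_ 0 id.
  apply/eqaddoE; apply/eqaddoP => _/posnumP[e].
  have : \forall y \near 0, (g - f) (y + x) = 0.
    by move: z0; rewrite (near_shift 0 x) subr0.
  apply: filterS => y /= yx0.
  rewrite -[X in `|X|]/((g - f) (y + x) - ((g - f) x + 0)).
  by rewrite (nbhs_singleton z0) addr0 subr0 yx0 normr0 mulr_ge0.
by have -> := diff_unique cL oL.
Qed.

Lemma Ck_ext (R : realType) (V W : normedModType R) k (A : set V)
    (f g : V -> W) :
  open A -> (forall x, A x -> f x = g x) -> Ck k A f -> Ck k A g.
Proof.
move=> oA; elim: k f g => [|k IH] f g fg /=.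
  move=> h x Ax; have nfg : \forall y \near x, f y = g y.
    by apply: filterS (open_nbhs_nbhs (conj oA Ax)) => y /fg.
  have := h x Ax; rewrite /continuous_at /prop_for -(fg x Ax) => hc.
  exact: cvg_trans (near_eq_cvg nfg) hc.
have nfg x : A x -> \forall y \near x, f y = g y.
  by move=> Ax; apply: filterS (open_nbhs_nbhs (conj oA Ax)) => y /fg.
move=> [h1 h2]; split.
  by move=> x Ax; exact: near_eq_differentiable (nfg x Ax) (h1 x Ax).
move=> v; apply: (IH (fun x => 'D_v f x)) => // x Ax.
exact: near_eq_derive (nfg x Ax).
Qed.

Lemma setX_open (T U : topologicalType) (A : set T) (B : set U) :
  open A -> open B -> open (A `*` B).
Proof.
rewrite !openE => oA oB [x y] [/= Ax By].
by exists (A, B) => //=; split; [exact: oA|exact: oB].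
Qed.

Lemma differentiable_prodfun (R : realType) (V V' W W' : normedModType R)
    (f : V -> W) (g : V' -> W') (p : V * V') :
  differentiable f p.1 -> differentiable g p.2 ->
  differentiable (fun q : V * V' => (f q.1, g q.2)) p /\
  'd (fun q : V * V' => (f q.1, g q.2)) p =
    (fun v => ('d f (p.1) v.1, 'd g (p.2) v.2)) :> (V * V' -> W * W').
Proof.
move=> df dg.
have d1 : differentiable (fst : V * V' -> V) p.
  by apply: linear_differentiable => ?; exact: cvg_fst.
have d2 : differentiable (snd : V * V' -> V') p.
  by apply: linear_differentiable => ?; exact: cvg_snd.
have df1 : differentiable (f \o fst) p by exact: differentiable_comp.
have dg2 : differentiable (g \o snd) p by exact: differentiable_comp.
split; first exact: differentiable_pair.
have c1 : continuous (fst : V * V' -> V) by move=> ?; exact: cvg_fst.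
have c2 : continuous (snd : V * V' -> V') by move=> ?; exact: cvg_snd.
have e1 : 'd (f \o fst) p = 'd f (p.1) \o fst :> (V * V' -> W).
  by rewrite (diff_comp d1 df) (diff_lin p c1).
have e2 : 'd (g \o snd) p = 'd g (p.2) \o snd :> (V * V' -> W').
  by rewrite (diff_comp d2 dg) (diff_lin p c2).
apply: (etrans (diff_pair df1 dg2)); apply/funext => v.
by congr (_, _); [exact: (congr1 (@^~ v) e1)|exact: (congr1 (@^~ v) e2)].
Qed.

Lemma Ck_prodfun (R : realType) (V V' W W' : normedModType R) k
    (A : set V) (B : set V') (f : V -> W) (g : V' -> W') :
  open A -> open B -> Ck k A f -> Ck k B g ->
  Ck k (A `*` B) (fun q => (f q.1, g q.2)).
Proof.
move=> oA oB; elim: k f g => [|k IH] f g /=.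
  move=> hf hg [x y] [/= Ax By]; rewrite /prop_for /continuous_at /=.
  apply: cvg_pair.
    by apply: (@cvg_comp _ _ _ fst f) (hf x Ax); exact: cvg_fst.
  by apply: (@cvg_comp _ _ _ snd g) (hg y By); exact: cvg_snd.
move=> [f1 f2] [g1 g2]; split.
  by move=> p [Ap Bp]; have [] := differentiable_prodfun (f1 _ Ap) (g1 _ Bp).
move=> v; have := IH _ _ (f2 v.1) (g2 v.2); apply: Ck_ext.
  exact: setX_open.
move=> p [Ap Bp]; have [dp dE] := differentiable_prodfun (f1 _ Ap) (g1 _ Bp).
by rewrite (deriveE _ dp) dE !deriveE //; [exact: g1|exact: f1].
Qed.

Lemma hausdorff_prod (T U : topologicalType) :
  hausdorff_space T -> hausdorff_space U -> hausdorff_space (T * U)%type.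
Proof.
move=> hT hU [x y] [x' y'] xy; congr (_, _).
  apply: hT => A B nA nB.
  have [|| [a b] []] := xy (A `*` setT) (B `*` setT); last by move=> [] ? _ [] ? _; exists a.
    by exists (A, setT) => //; split => //=; exact: filterT.
  by exists (B, setT) => //; split => //=; exact: filterT.
apply: hU => A B nA nB.
have [|| [a b] []] := xy (setT `*` A) (setT `*` B); last by move=> [] _ ? [] _ ?; exists b.
  by exists (setT, A) => //; split => //=; exact: filterT.
by exists (setT, B) => //; split => //=; exact: filterT.
Qed.

Lemma second_countable_prod (T U : topologicalType) :
  @second_countable T -> @second_countable U ->
  @second_countable (T * U)%type.
Proof.
move=> [B cB [oB bB]] [C cC [oC bC]].
exists [set P.1 `*` P.2 | P in B `*` C].
  exact: sub_countable (card_image_le _ _) (countableX cB cC).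
split; first by move=> _ [[P Q] [/oB oP /oC oQ] <-]; exact: setX_open.
move=> [x y] A [[P Q] [/= /bB [P' [BP' P'x] P'P] /bC [Q' [CQ' Q'y] Q'Q]] PQA].
exists (P' `*` Q') => /=.
  by split => //; exists (P', Q').
by move=> [a b] [/= /P'P ? /Q'Q ?]; exact: PQA.
Qed.

Lemma finite_dim_prod (R : realType) (V W : normedModType R) :
  finite_dim V -> finite_dim W -> finite_dim (V * W)%type.
Proof.
move=> [m [f [f' fK f'K]]] [n [g [g' gK g'K]]].
pose h (v : V * W) := row_mx (f v.1) (g v.2).
have hl : linear h.
  by move=> a u v; rewrite /h !linearP /= scale_row_mx add_row_mx.
pose hM := GRing.isLinear.Build _ _ _ _ _ hl.
pose hL : {linear _ -> _} := HB.pack h hM.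
exists (m + n)%N, hL; exists (fun r => (f' (lsubmx r), g' (rsubmx r))).
  by move=> [v w]; rewrite /= /h row_mxKl row_mxKr fK gK.
by move=> r; rewrite /= /h f'K g'K hsubmxK.
Qed.

(* A homeomorphism from an open set of T onto an open set of V; the values of
   [chart_fun] outside [chart_dom] and of [chart_inv] outside the image are
   irrelevant. *)
Record chart (R : realType) (T : topologicalType) (V : normedModType R) :=
  Chart {
    chart_dom : set T;
    chart_fun :> T -> V;
    chart_inv : V -> T;
    chart_dom_open : open chart_dom;
    chart_cod_open : open (chart_fun @` chart_dom);
    chartK : forall x, chart_dom x -> chart_inv (chart_fun x) = x;
    chart_continuous : forall x, chart_dom x -> {for x, continuous chart_fun};
    chart_inv_continuous :
      forall x, chart_dom x -> {for chart_fun x, continuous chart_inv} }.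

(* Second countable Hausdorff manifolds without boundary, of dimension
   [dim model].  The atlas need not be maximal.  [chart_at x] is a preferred
   chart around x; it is used only to identify the tangent space at x with the
   model space. *)
Record manifold (R : realType) := Manifold {
  man_top :> topologicalType;
  model : normedModType R;
  model_finite_dim : finite_dim model;
  man_hausdorff : hausdorff_space man_top;
  man_second_countable : @second_countable man_top;
  atlas : set (chart man_top model);
  chart_at : man_top -> chart man_top model;
  chart_at_atlas : forall x, atlas (chart_at x);
  chart_at_dom : forall x, chart_dom (chart_at x) x;
  atlas_compatible : forall c d, atlas c -> atlas d ->
    Cinfty (c @` (chart_dom c `&` chart_dom d)) (d \o chart_inv c) }.

Lemma image_prodfun (T T' U U' : Type) (A : set T) (B : set T')
    (f : T -> U) (g : T' -> U') :
  (fun q : T * T' => (f q.1, g q.2)) @` (A `*` B) = (f @` A) `*` (g @` B).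
Proof.
apply/seteqP; split => [_ [[x y] [Ax By] <-]|[_ _] [/= [x Ax <-] [y By <-]]].
  by split; [exists x|exists y].
by exists (x, y).
Qed.

Lemma continuous_prodfun (T T' U U' : topologicalType)
    (f : T -> U) (g : T' -> U') (p : T * T') :
  {for p.1, continuous f} -> {for p.2, continuous g} ->
  {for p, continuous (fun q : T * T' => (f q.1, g q.2))}.
Proof.
move: p => [x y] cf cg; rewrite /prop_for /continuous_at /=.
apply: cvg_pair.
  by apply: (@cvg_comp _ _ _ fst f) cf; exact: cvg_fst.
by apply: (@cvg_comp _ _ _ snd g) cg; exact: cvg_snd.
Qed.

Definition prod_chart (R : realType) (T T' : topologicalType)
    (V V' : normedModType R) (c : chart T V) (d : chart T' V') :
  chart (T * T')%type (V * V')%type.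
Proof.
refine (@Chart R (T * T')%type (V * V')%type (chart_dom c `*` chart_dom d)
  (fun q => (c q.1, d q.2)) (fun v => (chart_inv c v.1, chart_inv d v.2))
  _ _ _ _ _).
- by apply: setX_open; exact: chart_dom_open.
- by rewrite image_prodfun; apply: setX_open; exact: chart_cod_open.
- by move=> [x y] [/= cx dy]; rewrite !chartK.
- by move=> [x y] [cx dy]; apply: continuous_prodfun; exact: chart_continuous.
- move=> [x y] [cx dy]; apply: continuous_prodfun;
  exact: chart_inv_continuous.
Defined.

Lemma chart_image_open (R : realType) (T : topologicalType)
    (V : normedModType R) (c : chart T V) (A : set T) :
  open A -> open (c @` (chart_dom c `&` A)).
Proof.
move=> oA; rewrite openE => _ [x [cx Ax] <-].
have n1 : nbhs (c x) (c @` chart_dom c).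
  by apply: open_nbhs_nbhs; split; [exact: chart_cod_open|exists x].
have n2 : nbhs (c x) (chart_inv c @^-1` A).
  apply: (chart_inv_continuous cx); rewrite chartK //.
  exact: open_nbhs_nbhs.
apply: filterS (filterI n1 n2) => _ [[y cy <-]] /=.
by rewrite chartK // => Ay; exists y.
Qed.

Definition mprod (R : realType) (M N : manifold R) : manifold R.
Proof.
refine (@Manifold R (M * N)%type (model M * model N)%type _ _ _
  [set e | exists c d, [/\ atlas c, atlas d & e = prod_chart c d]]
  (fun p => prod_chart (chart_at p.1) (chart_at p.2)) _ _ _).
- by apply: finite_dim_prod; exact: model_finite_dim.
- by apply: hausdorff_prod; exact: man_hausdorff.
- by apply: second_countable_prod; exact: man_second_countable.
- move=> p; exists (chart_at p.1), (chart_at p.2).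
  by split => //; exact: chart_at_atlas.
- by move=> p; split; exact: chart_at_dom.
- move=> _ _ [c [d [ac ad ->]]] [c' [d' [ac' ad' ->]]] k /=.
  have := @Ck_prodfun R _ _ _ _ k _ _ _ _ _ _ (atlas_compatible ac ac' k)
    (atlas_compatible ad ad' k).
  rewrite -setXI image_prodfun; apply; apply: chart_image_open;
  exact: chart_dom_open.
Defined.

Lemma rV0_eq (R : realType) (x y : 'rV[R]_0) : x = y.
Proof. by apply/rowP => -[]. Qed.

Definition rV0_chart (R : realType) : chart 'rV[R]_0 'rV[R]_0.
Proof.
refine (@Chart R 'rV[R]_0 'rV[R]_0 setT id id openT _ _ _ _) => //.
- by rewrite image_id; exact: openT.
- by move=> x _; exact: cvg_id.
- by move=> x _; exact: cvg_id.
Defined.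

Definition mpoint (R : realType) : manifold R.
Proof.
refine (@Manifold R 'rV[R]_0 'rV[R]_0 _ _ _ [set rV0_chart R]
  (fun=> rV0_chart R) (fun=> erefl) (fun=> I) _).
- by exists 0%N, idfun, idfun.
- by move=> x y _; exact: rV0_eq.
- exists [set setT] => //; split; first by move=> _ ->; exact: openT.
  move=> x A nA; exists setT => //= y _.
  by rewrite (rV0_eq y x); exact: nbhs_singleton.
- move=> _ _ -> -> k; have fE (f : 'rV[R]_0 -> 'rV[R]_0) : f = cst 0.
    by apply: funext => x; exact: rV0_eq.
  rewrite [X in Ck _ _ X]fE; elim: k => [|k IH] /=.
    by move=> ? _; exact: cst_continuous.
  by split => [x _|v]; [exact: differentiable_cst|rewrite [X in Ck _ _ X]fE].
Defined.

Fixpoint mpow (R : realType) (M : manifold R) (n : nat) : manifold R :=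
  if n is n'.+1 then mprod M (mpow M n') else mpoint R.

(* [A] is meant to be open. *)
Definition smooth_on (R : realType) (M N : manifold R) (A : set M)
    (f : M -> N) : Prop :=
  (forall x, A x -> {for x, continuous f}) /\
  forall c d, atlas c -> atlas d ->
    Cinfty (c @` (chart_dom c `&` A `&` f @^-1` chart_dom d))
           (d \o f \o chart_inv c).

Definition smooth (R : realType) (M N : manifold R) (f : M -> N) : Prop :=
  smooth_on setT f.

(* Vector-valued functions; [A] is meant to be open. *)
Definition smooth_fun_on (R : realType) (M : manifold R) (V : normedModType R)
    (A : set M) (f : M -> V) : Prop :=
  forall c, atlas c -> Cinfty (c @` (chart_dom c `&` A)) (f \o chart_inv c).

Definition smooth_fun (R : realType) (M : manifold R) (V : normedModType R)
    (f : M -> V) : Prop := smooth_fun_on setT f.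

(* Smoothness of a function on an arbitrary subset, e.g. an embedded
   submanifold: local extendability to a smooth function. *)
Definition smooth_fun_within (R : realType) (M : manifold R)
    (V : normedModType R) (A : set M) (f : M -> V) : Prop :=
  forall x, A x -> exists (W : set M) (g : M -> V),
    [/\ open W, W x, smooth_fun_on W g & forall y, A y -> W y -> f y = g y].

Definition diffeo_on (R : realType) (M N : manifold R) (A : set M) (B : set N)
    (f : M -> N) (g : N -> M) : Prop :=
  [/\ open A, open B, smooth_on A f & smooth_on B g] /\
  (forall x, A x -> B (f x) /\ g (f x) = x) /\
  (forall y, B y -> A (g y) /\ f (g y) = y).

(* The tangent space at x, identified with the model space through the
   coordinates of [chart_at x]. *)
Definition tangent (R : realType) (M : manifold R) (x : M) : normedModType R :=
  model M.

Definition mdiff (R : realType) (M N : manifold R) (f : M -> N) (x : M) :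
    tangent x -> tangent (f x) :=
  'd (chart_at (f x) \o f \o chart_inv (chart_at x)) (chart_at x x).
Arguments mdiff {R M N} f x _.

Definition dfun (R : realType) (M : manifold R) (V : normedModType R)
    (f : M -> V) (x : M) : tangent x -> V :=
  'd (f \o chart_inv (chart_at x)) (chart_at x x).
Arguments dfun {R M V} f x _.

Definition D1 (R : realType) (M N P : manifold R) (f : mprod M N -> P)
    (x : mprod M N) (v : tangent x.1) : tangent (f x) :=
  mdiff f x (v, 0).
Definition D2 (R : realType) (M N P : manifold R) (f : mprod M N -> P)
    (x : mprod M N) (w : tangent x.2) : tangent (f x) :=
  mdiff f x (0, w).
Arguments D1 {R M N P} f x _.
Arguments D2 {R M N P} f x _.

(* Change of coordinates between a tangent space and the chart [c]. *)
Definition to_chart (R : realType) (M : manifold R)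
    (c : chart M (model M)) (x : M) : tangent x -> model M :=
  'd (c \o chart_inv (chart_at x)) (chart_at x x).
Definition of_chart (R : realType) (M : manifold R)
    (c : chart M (model M)) (x : M) : model M -> tangent x :=
  'd (chart_at x \o chart_inv c) (c x).
Arguments to_chart {R M} c x _.
Arguments of_chart {R M} c x _.

Definition submersion (R : realType) (M N : manifold R) (f : M -> N) : Prop :=
  smooth f /\ forall x (w : tangent (f x)), exists v : tangent x, mdiff f x v = w.

Definition embedding (R : realType) (M N : manifold R) (f : M -> N) : Prop :=
  [/\ smooth f, injective f,
      forall x, injective (mdiff f x)
    & forall A : set M, open A ->
        exists2 B : set N, open B & f @` A = B `&` range f].

Definition local_diffeo (R : realType) (M N : manifold R) (f : M -> N) : Prop :=
  forall x, exists (A : set M) (B : set N) (g : N -> M),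
    A x /\ diffeo_on A B f g.

Record lie_group (R : realType) := LieGroup {
  lg_man :> manifold R;
  lg_mul : lg_man -> lg_man -> lg_man;
  lg_one : lg_man;
  lg_inv : lg_man -> lg_man;
  lg_mulA : associative lg_mul;
  lg_mul1 : left_id lg_one lg_mul;
  lg_mulV : left_inverse lg_one lg_inv lg_mul;
  lg_mul_smooth : smooth (fun p : mprod lg_man lg_man => lg_mul p.1 p.2);
  lg_inv_smooth : smooth lg_inv }.

Record left_action (R : realType) (G : lie_group R) (X : manifold R)
    (l : G -> X -> X) : Prop := LeftAction {
  lact1 : forall x, l (lg_one G) x = x;
  lactM : forall g h x, l (lg_mul g h) x = l g (l h x);
  lact_smooth : smooth (fun p : mprod G X => l p.1 p.2) }.

(* [r g f] is r_g(f). *)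
Record right_action (R : realType) (G : lie_group R) (X : manifold R)
    (r : G -> X -> X) : Prop := RightAction {
  ract1 : forall x, r (lg_one G) x = x;
  ractM : forall g h x, r (lg_mul g h) x = r h (r g x);
  ract_smooth : smooth (fun p : mprod G X => r p.1 p.2) }.

Definition free_action (R : realType) (G : lie_group R) (X : manifold R)
    (l : G -> X -> X) : Prop :=
  forall g x, l g x = x -> g = lg_one G.

Record principal_bundle (R : realType) (G : lie_group R) (X Q : manifold R)
    (l : G -> X -> X) (pi : X -> Q) : Prop := PrincipalBundle {
  pb_action : left_action l;
  pb_free : free_action l;
  pb_submersion : submersion pi;
  pb_surjective : forall q, exists x, pi x = q;
  pb_orbits : forall x y, pi x = pi y <-> exists g, y = l g x }.

(* The quotient manifold X/G: points of [quo] are the orbits, and the smooth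
   structure is the (unique) one making the projection a submersion. *)
Record quotient (R : realType) (G : lie_group R) (X : manifold R)
    (l : G -> X -> X) := Quotient {
  quo :> manifold R;
  quo_proj : X -> quo;
  quo_principal : principal_bundle l quo_proj }.

Definition trivializing_chart (R : realType) (E M F : manifold R)
    (phi : E -> M) (U : set M) (Phi : E -> mprod M F) : Prop :=
  (exists Psi, diffeo_on (phi @^-1` U) (U `*` setT : set (mprod M F)) Phi Psi)
  /\ forall e, U (phi e) -> (Phi e).1 = phi e.

Record fiber_bundle (R : realType) (E M F : manifold R) := FiberBundle {
  fb_proj :> E -> M;
  fb_smooth : smooth fb_proj;
  fb_trivial : forall m, exists (U : set M) (Phi : E -> mprod M F),
    [/\ open U, U m & trivializing_chart fb_proj U Phi] }.

Record bundle_action (R : realType) (G : lie_group R) (E M F : manifold R)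
    (phi : fiber_bundle E M F) := BundleAction {
  actE : G -> E -> E;
  actM : G -> M -> M;
  actF : G -> F -> F;
  actE_action : left_action actE;
  actE_free : free_action actE;
  actM_action : left_action actM;
  actM_free : free_action actM;
  actF_action : right_action actF;
  actQ : quotient actM;
  act_equivariant : forall g e, phi (actE g e) = actM g (phi e);
  act_trivial : forall m, exists (U : set M) (Phi : E -> mprod M F),
    [/\ open U, U m, forall g x, U x -> U (actM g x),
        trivializing_chart phi U Phi
      & forall g e, U (phi e) ->
          Phi (actE g e) = (actM g (Phi e).1, actF (lg_inv g) (Phi e).2)] }.

Definition Cprime (R : realType) (E M : manifold R) : manifold R := mprod E M.

Definition Csecond (R : realType) (E M F : manifold R) (phi : fiber_bundle E M F) :
    set (mprod (Cprime E M) (Cprime E M)) :=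
  [set q | q.1.2 = phi q.2.1].

(* [ivcm] is the infinitesimal variation chaining map; [ivcm x0 x1] is
   meaningful only when (x0, x1) belongs to Csecond. *)
Record dlps (R : realType) (E M F : manifold R) (phi : fiber_bundle E M F) :=
  Dlps {
    Ld : Cprime E M -> R;
    Ld_smooth : smooth_fun (V := R^o) Ld;
    ivcm : forall x0 x1 : Cprime E M, tangent x1.1 -> tangent x0.1;
    ivcm_linear : forall x0 x1, Csecond phi (x0, x1) -> linear (@ivcm x0 x1);
    ivcm_vertical : forall x0 x1, Csecond phi (x0, x1) ->
      forall v, mdiff phi x0.1 (@ivcm x0 x1 v) = 0;
    (* the matrix of [ivcm] in coordinates depends smoothly on (x0, x1) *)
    ivcm_smooth : forall c0 c1 : chart E (model E), atlas c0 -> atlas c1 ->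
      forall u : model E,
      smooth_fun_within
        [set q | [/\ Csecond phi q, chart_dom c0 q.1.1 & chart_dom c1 q.2.1]]
        (fun q => to_chart c0 q.1.1 (@ivcm q.1 q.2 (of_chart c1 q.2.1 u))) }.
Arguments ivcm {R E M F phi} d x0 x1 _.

(* Elements of X^N, and tangent vectors to X^N, from their components. *)
Fixpoint mtuple (R : realType) (X : manifold R) (N : nat) :
    ('I_N -> X) -> mpow X N :=
  match N with
  | 0 => fun=> (0 : 'rV[R]_0)
  | N'.+1 => fun u => (u ord0, mtuple (fun i => u (lift ord0 i)))
  end.

Fixpoint ttuple (R : realType) (X : manifold R) (N : nat) :
    ('I_N -> model X) -> model (mpow X N) :=
  match N with
  | 0 => fun=> (0 : 'rV[R]_0)
  | N'.+1 => fun v => (v ord0, ttuple (fun i => v (lift ord0 i)))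
  end.

Fixpoint discrete_action (R : realType) (X : manifold R) (L : X -> R)
    (N : nat) : mpow X N -> R :=
  match N with
  | 0 => fun=> 0
  | N'.+1 => fun p => L p.1 + discrete_action L p.2
  end.

Lemma discrete_actionE (R : realType) (X : manifold R) (L : X -> R) (N : nat)
    (u : 'I_N -> X) :
  discrete_action L (mtuple u) = \sum_(k < N) L (u k).
Proof.
elim: N u => [|N IH] u /=; first by rewrite big_ord0.
by rewrite IH big_ord_recl.
Qed.

(* A path ((e_0, m_1), ..., (e_(N-1), m_N)) is the function
   u k = (e_k, m_(k+1)) on 'I_N. *)
Definition discrete_path (R : realType) (E M F : manifold R)
    (phi : fiber_bundle E M F) (N : nat) (u : 'I_N -> Cprime E M) : Prop :=
  forall i j : 'I_N, j = i.+1 :> nat -> Csecond phi (u i, u j).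

(* [du k] = (de_k, dm_(k+1)); the value of [te] at 0 is not used. *)
Definition fixed_endpoint_variation (R : realType) (E M F : manifold R)
    (phi : fiber_bundle E M F) (S : dlps phi) (N : nat) (u : 'I_N -> Cprime E M)
    (du : forall k, tangent (u k)) : Prop :=
  [/\ forall i j : 'I_N, j = i.+1 :> nat ->
        (du i).2 = mdiff phi (u j).1 (du j).1,
      forall i : 'I_N, N = i.+1 -> (du i).2 = 0
    & exists te : forall k, tangent (u k).1,
      [/\ forall i : 'I_N, N = i.+1 -> (du i).1 = te i,
          forall i j : 'I_N, j = i.+1 :> nat -> (0 < i)%N ->
            (du i).1 = te i + ivcm S (u i) (u j) (te j)
        & forall i j : 'I_N, i = 0 :> nat -> j = 1 :> nat ->
            (du i).1 = ivcm S (u i) (u j) (te j)]].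

Arguments fixed_endpoint_variation {R E M F phi} S {N} u du.

Definition trajectory (R : realType) (E M F : manifold R)
    (phi : fiber_bundle E M F) (S : dlps phi) (N : nat)
    (u : 'I_N -> Cprime E M) : Prop :=
  discrete_path phi u /\
  forall du, fixed_endpoint_variation S u du ->
    dfun (V := R^o) (discrete_action (Ld S) (N := N)) (mtuple u) (ttuple du)
      = 0.

Record symmetry_group (R : realType) (G : lie_group R) (E M F : manifold R)
    (phi : fiber_bundle E M F) (S : dlps phi) := SymmetryGroup {
  sym_action :> bundle_action G phi;
  sym_Ld : forall g x,
    Ld S (actE sym_action g x.1, actM sym_action g x.2) = Ld S x;
  sym_ivcm : forall g (x0 x1 : Cprime E M), Csecond phi (x0, x1) ->
    forall v : tangent x1.1,
    ivcm S (actE sym_action g x0.1, actM sym_action g x0.2)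
      (actE sym_action g x1.1, actM sym_action g x1.2)
      (mdiff (actE sym_action g) x1.1 v)
    = mdiff (actE sym_action g) x0.1 (ivcm S x0 x1 v) }.

Record discrete_connection (R : realType) (G : lie_group R) (M : manifold R)
    (l : G -> M -> M) (Q : quotient l) := DiscreteConnection {
  Hor : set (mprod M M);
  Hor_invariant : forall g m0 m1, Hor (m0, m1) -> Hor (l g m0, l g m1);
  Hor_diagonal : forall m, Hor (m, m);
  (* [Hor] is the image of an embedding [iota], and the restriction of
     id x pi to it is an injective local diffeomorphism *)
  Hor_submanifold : exists (H : manifold R) (iota : H -> mprod M M),
    [/\ embedding iota, range iota = Hor,
        local_diffeo (fun h => ((iota h).1, quo_proj Q (iota h).2) : mprod M Q)
      & injective (fun h => ((iota h).1, quo_proj Q (iota h).2))];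
  Hor_global : forall m0 (q : Q), exists2 m1, Hor (m0, m1) & quo_proj Q m1 = q;
  Ad : M -> M -> G;
  AdP : forall m0 m1 g, Hor (m0, l (lg_inv g) m1) <-> g = Ad m0 m1;
  Ad_smooth : smooth (fun p : mprod M M => Ad p.1 p.2) }.

Definition conj_action (R : realType) (G : lie_group R) (E : manifold R)
    (l : G -> E -> E) (g : G) (p : mprod E G) : mprod E G :=
  (l g p.1, lg_mul (lg_mul g p.2) (lg_inv g)).

Section Reduction.
Context {R : realType} {G : lie_group R} {E M F : manifold R}.
Context {phi : fiber_bundle E M F} {S : dlps phi}.

Definition Upsilon1 (sym : symmetry_group G S)
    (A : discrete_connection (actQ sym)) (GE : quotient (conj_action (actE sym)))
    (x : Cprime E M) : GE :=
  quo_proj GE (x.1, Ad A (phi x.1) x.2).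

Definition Upsilon (sym : symmetry_group G S)
    (A : discrete_connection (actQ sym)) (GE : quotient (conj_action (actE sym)))
    (x : Cprime E M) : Cprime GE (actQ sym) :=
  (Upsilon1 A GE x, quo_proj (actQ sym) x.2).

(* [Sr] is the reduced system of [S].  Upsilon is onto and each
   D1 (Upsilon1 A GE) x1 is bijective, so [red_Ld] and [red_ivcm] determine its
   Lagrangian and its chaining map. *)
Record reduced_system (sym : symmetry_group G S)
    (A : discrete_connection (actQ sym)) (GE : quotient (conj_action (actE sym)))
    (p : fiber_bundle GE (actQ sym) (mprod F G)) (Sr : dlps p) : Prop :=
  ReducedSystem {
    red_proj : forall e w,
      p (quo_proj GE (e, w)) = quo_proj (actQ sym) (phi e);
    red_Ld : forall x, Ld Sr (Upsilon A GE x) = Ld S x;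
    red_ivcm : forall x0 x1 : Cprime E M, Csecond phi (x0, x1) ->
      forall v : tangent x1.1,
      ivcm Sr (Upsilon A GE x0) (Upsilon A GE x1) (D1 (Upsilon1 A GE) x1 v)
      = D1 (Upsilon1 A GE) x0 (ivcm S x0 x1 v)
        + D2 (Upsilon1 A GE) x0 (mdiff phi x1.1 v) }.

End Reduction.

(* Main.v *)
Require Import Defs.
From HB Require Import structures.
From mathcomp Require Import all_boot all_order all_algebra.
From mathcomp Require Import all_classical all_reals all_analysis.

(* Two facts about Upsilon suffice.  First, (e, m) is determined by phi e and
   Upsilon (e, m), and exists as soon as phi e lies over the base point of the
   given class: freeness of the action and the horizontal fibers of A allow one
   to solve for e and then for m; hence reduced paths lift uniquely, one step at
   a time.  Second, S_d is the pullback of the reduced action by Upsilon, and the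
   differential of Upsilon sends fixed-endpoint variations of a path to
   fixed-endpoint variations of its image (the new free vectors being the images
   of the old ones under D1 Upsilon1), because the chaining map takes vertical
   values.  So a path is critical if its image is. *)

Set Implicit Arguments.
Unset Strict Implicit.
Unset Printing Implicit Defensive.

Import Order.TTheory GRing.Theory Num.Theory.
Import numFieldNormedType.Exports.

(** * Differentials in normed modules: locality and product projections *)

Section NormedModules.
Local Open Scope classical_set_scope.
Local Open Scope ring_scope.
Context {R : realType}.

Lemma near_eq_diff (V W : normedModType R) (f g : V -> W) (x : V) :
  (\forall y \near x, f y = g y) -> differentiable f x ->
  'd f x = 'd g x :> (V -> W).
Proof.
move=> fg df; have dg := near_eq_differentiable fg df.
by apply/funext => v; rewrite -!deriveE //; exact: near_eq_derive.
Qed.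

Lemma differentiable_fst (V W : normedModType R) (x : V * W) :
  differentiable (fst : V * W -> V) x.
Proof. by apply: linear_differentiable => ?; exact: cvg_fst. Qed.

Lemma differentiable_snd (V W : normedModType R) (x : V * W) :
  differentiable (snd : V * W -> W) x.
Proof. by apply: linear_differentiable => ?; exact: cvg_snd. Qed.

Lemma diff_fst (V W : normedModType R) (x : V * W) :
  'd (fst : V * W -> V) x = fst :> (V * W -> V).
Proof. by apply: diff_lin => ?; exact: cvg_fst. Qed.

Lemma diff_snd (V W : normedModType R) (x : V * W) :
  'd (snd : V * W -> W) x = snd :> (V * W -> W).
Proof. by apply: diff_lin => ?; exact: cvg_snd. Qed.

End NormedModules.

(** * Differential calculus on manifolds: chain rule, products, discrete action *)

Section Manifolds.
Local Open Scope classical_set_scope.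
Local Open Scope ring_scope.
Context {R : realType}.

(** Continuity is a separate clause because charts take arbitrary values outside their domains:
    differentiability of the coordinate expression alone would not keep [f] near [x] inside the
    chart at [f x]. *)
Definition mdifferentiable (M N : manifold R) (f : M -> N) (x : M) : Prop :=
  {for x, continuous f} /\
  differentiable (chart_at (f x) \o f \o chart_inv (chart_at x)) (chart_at x x).

Lemma mdiffD (M N : manifold R) (f : M -> N) (x : M) (v w : tangent x) :
  mdiff f x (v + w) = mdiff f x v + mdiff f x w.
Proof. exact: raddfD. Qed.

Lemma mdiff0 (M N : manifold R) (f : M -> N) (x : M) : mdiff f x 0 = 0.
Proof. exact: raddf0. Qed.

Lemma chart_at_invK (M : manifold R) (x : M) :
  chart_inv (chart_at x) (chart_at x x) = x.
Proof. by rewrite chartK //; exact: chart_at_dom. Qed.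

Lemma nbhs_chart_inv (M : manifold R) (x : M) (A : set M) :
  nbhs x A -> \forall y \near chart_at x x, A (chart_inv (chart_at x) y).
Proof.
move=> nA; apply: (chart_inv_continuous (chart_at_dom x)).
by rewrite chart_at_invK.
Qed.

Lemma near_chart_dom (M : manifold R) (x : M) : nbhs x (chart_dom (chart_at x)).
Proof.
by apply: open_nbhs_nbhs; split; [exact: chart_dom_open|exact: chart_at_dom].
Qed.

Lemma near_chart_invK (M : manifold R) (x : M) :
  \forall y \near chart_at x x, chart_at x (chart_inv (chart_at x) y) = y.
Proof.
have n1 : nbhs (chart_at x x) (chart_at x @` chart_dom (chart_at x)).
  apply: open_nbhs_nbhs; split; first exact: chart_cod_open.
  by exists x => //; exact: chart_at_dom.
by apply: filterS n1 => _ [y cy <-]; rewrite chartK.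
Qed.

Lemma smooth_mdifferentiable (M N : manifold R) (f : M -> N) (x : M) :
  smooth f -> mdifferentiable f x.
Proof.
move=> [cf sf]; split; first exact: cf.
have [d _] := sf _ _ (chart_at_atlas x) (chart_at_atlas (f x)) 1%N.
apply: d; exists x => //; split; first by split=> //; exact: chart_at_dom.
exact: chart_at_dom.
Qed.

Lemma smooth_fun_differentiable (M : manifold R) (V : normedModType R)
    (f : M -> V) (x : M) :
  smooth_fun f -> differentiable (f \o chart_inv (chart_at x)) (chart_at x x).
Proof.
move=> sf; have [d _] := sf _ (chart_at_atlas x) 1%N.
by apply: d; exists x => //; split=> //; exact: chart_at_dom.
Qed.

(** The inserted chart at [f x] cancels against its inverse only on its domain, and continuity of
    [f] keeps nearby points there. Equality near the point is enough, since differentials are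
    local. *)
Lemma near_comp_chart (M N : manifold R) (T : Type) (f : M -> N) (g : N -> T)
    (x : M) : {for x, continuous f} ->
  \forall y \near chart_at x x,
    ((g \o chart_inv (chart_at (f x))) \o
      (chart_at (f x) \o f \o chart_inv (chart_at x))) y =
    (g \o f \o chart_inv (chart_at x)) y.
Proof.
move=> cf; have := nbhs_chart_inv (cf _ (near_chart_dom (f x))).
by apply: filterS => y /= cy; rewrite chartK.
Qed.

Lemma dfun_comp (M N : manifold R) (V : normedModType R) (f : M -> N)
    (L : N -> V) (x : M) (v : tangent x) :
  mdifferentiable f x ->
  differentiable (L \o chart_inv (chart_at (f x))) (chart_at (f x) (f x)) ->
  dfun (L \o f) x v = dfun L (f x) (mdiff f x v).
Proof.
move=> [cf df] dL; have e := near_comp_chart L cf.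
rewrite /dfun /mdiff.
have dL' : differentiable (L \o chart_inv (chart_at (f x)))
   ((chart_at (f x) \o f \o chart_inv (chart_at x)) (chart_at x x)).
  by rewrite /= chart_at_invK.
rewrite -(near_eq_diff e (differentiable_comp df dL')).
by rewrite (diff_comp df dL') /= chart_at_invK.
Qed.

Lemma mdifferentiable_comp (M N P : manifold R) (f : M -> N) (g : N -> P)
    (x : M) : mdifferentiable f x -> mdifferentiable g (f x) ->
  mdifferentiable (g \o f) x.
Proof.
move=> [cf df] [cg dg]; split; first exact: continuous_comp.
apply: (near_eq_differentiable (near_comp_chart (chart_at (g (f x)) \o g) cf)).
apply: (differentiable_comp df (g := (chart_at (g (f x)) \o g) \o _)).
by rewrite /= chart_at_invK.
Qed.

Lemma mdiff_comp (M N P : manifold R) (f : M -> N) (g : N -> P) (x : M)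
    (v : tangent x) : mdifferentiable f x -> mdifferentiable g (f x) ->
  mdiff (g \o f) x v = mdiff g (f x) (mdiff f x v).
Proof.
(* By conversion, [mdiff g] is the [dfun] of [g] followed by the fixed chart at [g (f x)]. *)
by move=> df [_ dg]; exact: (dfun_comp (L := chart_at (g (f x)) \o g) v df dg).
Qed.

Lemma near_fst_chart (M N : manifold R) (x : mprod M N) :
  \forall y \near chart_at x x,
    fst y = (chart_at x.1 \o fst \o chart_inv (chart_at x)) y.
Proof.
have h : \forall y \near chart_at x x,
    chart_at x.1 (chart_inv (chart_at x.1) y.1) = y.1.
  exact: (cvg_fst (near_chart_invK x.1)).
by apply: filterS h => y /= ->.
Qed.

Lemma near_snd_chart (M N : manifold R) (x : mprod M N) :
  \forall y \near chart_at x x,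
    snd y = (chart_at x.2 \o snd \o chart_inv (chart_at x)) y.
Proof.
have h : \forall y \near chart_at x x,
    chart_at x.2 (chart_inv (chart_at x.2) y.2) = y.2.
  exact: (cvg_snd (near_chart_invK x.2)).
by apply: filterS h => y /= ->.
Qed.

Lemma mdifferentiable_fst (M N : manifold R) (x : mprod M N) :
  mdifferentiable (fst : mprod M N -> M) x.
Proof.
split; first exact: cvg_fst.
exact: near_eq_differentiable (near_fst_chart x) (differentiable_fst _).
Qed.

Lemma mdifferentiable_snd (M N : manifold R) (x : mprod M N) :
  mdifferentiable (snd : mprod M N -> N) x.
Proof.
split; first exact: cvg_snd.
exact: near_eq_differentiable (near_snd_chart x) (differentiable_snd _).
Qed.

Lemma mdiff_fst (M N : manifold R) (x : mprod M N) (v : tangent x) :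
  mdiff (fst : mprod M N -> M) x v = v.1.
Proof.
rewrite /mdiff -(near_eq_diff (near_fst_chart x)) ?diff_fst //.
exact: differentiable_fst.
Qed.

Lemma mdiff_snd (M N : manifold R) (x : mprod M N) (v : tangent x) :
  mdiff (snd : mprod M N -> N) x v = v.2.
Proof.
rewrite /mdiff -(near_eq_diff (near_snd_chart x)) ?diff_snd //.
exact: differentiable_snd.
Qed.

Lemma mdifferentiable_pair (X M N : manifold R) (f : X -> M) (g : X -> N)
    (x : X) : mdifferentiable f x -> mdifferentiable g x ->
  mdifferentiable (fun y => (f y, g y) : mprod M N) x.
Proof.
move=> [cf df] [cg dg]; split; first exact: cvg_pair.
exact: differentiable_pair df dg.
Qed.

Lemma mdiff_pair (X M N : manifold R) (f : X -> M) (g : X -> N) (x : X)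
    (v : tangent x) : mdifferentiable f x -> mdifferentiable g x ->
  mdiff (fun y => (f y, g y) : mprod M N) x v = (mdiff f x v, mdiff g x v).
Proof. by move=> [_ df] [_ dg]; exact: (congr1 (@^~ v) (diff_pair df dg)). Qed.

Lemma mdiff_D12 (M N P : manifold R) (f : mprod M N -> P) (x : mprod M N)
    (v : tangent x) : mdiff f x v = D1 f x v.1 + D2 f x v.2.
Proof.
rewrite /D1 /D2 -mdiffD; congr (mdiff f x _).
by case: v => v w; congr (_, _); rewrite ?addr0 ?add0r.
Qed.

Lemma D1D (M N P : manifold R) (f : mprod M N -> P) (x : mprod M N)
    (v w : tangent x.1) : D1 f x (v + w) = D1 f x v + D1 f x w.
Proof.
by rewrite /D1 -mdiffD; congr (mdiff f x _); congr (_, _); rewrite addr0.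
Qed.

Lemma D20 (M N P : manifold R) (f : mprod M N -> P) (x : mprod M N) :
  D2 f x 0 = 0.
Proof. exact: mdiff0. Qed.

Lemma dfun_discrete_action (X : manifold R) (L : X -> R) (N : nat)
    (u : 'I_N -> X) (du : forall k, tangent (u k)) :
  smooth_fun (V := R^o) L ->
  dfun (V := R^o) (discrete_action L (N := N)) (mtuple u) (ttuple du)
    = \sum_(k < N) dfun (V := R^o) L (u k) (du k).
Proof.
move=> sL.
(* The differential of a sum splits only for differentiable summands, so the induction carries
   differentiability of the tail along with the formula. *)
suff [] : differentiable ((discrete_action L (N := N) : _ -> R^o) \o
      chart_inv (chart_at (mtuple u))) (chart_at (mtuple u) (mtuple u)) /\
    dfun (V := R^o) (discrete_action L (N := N)) (mtuple u) (ttuple du)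
    = \sum_(k < N) dfun (V := R^o) L (u k) (du k) by [].
elim: N u du => [|N IH] u du.
  split; first exact: differentiable_cst.
  by rewrite big_ord0 /dfun (_ : _ \o _ = cst 0) // diff_cst.
have [d2 e2] := IH _ (fun i => du (lift ord0 i)).
have d1 := smooth_fun_differentiable (u ord0) sL.
set c := chart_at _ in d2; set c0 := chart_at _ in d1.
pose F1 := ((L : X -> R^o) \o chart_inv c0) \o fst : _ * model (mpow X N) -> R^o.
pose F2 := ((discrete_action L (N := N) : _ -> R^o) \o chart_inv c) \o snd :
  model X * _ -> R^o.
set x := chart_at _ (mtuple u).
have D1 : differentiable F1 x.
  exact: (differentiable_comp (differentiable_fst x) d1).
have D2 : differentiable F2 x.
  exact: (differentiable_comp (differentiable_snd x) d2).
split; first exact: differentiableD D1 D2.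
rewrite big_ord_recl -e2.
(* The chart of a product is the product of the charts, so in coordinates the action is literally
   [F1 + F2]: head term plus tail. *)
have -> : dfun (V := R^o) (discrete_action L (N := N.+1)) (mtuple u) (ttuple du)
  = 'd (F1 + F2) x (ttuple du) by [].
rewrite diffD //; congr (_ + _).
  by rewrite diff_comp ?diff_fst //; exact: differentiable_fst.
by rewrite diff_comp ?diff_snd //; exact: differentiable_snd.
Qed.

End Manifolds.

(** * Right-sided group laws *)

Section LieGroups.
Context {R : realType} {G : lie_group R}.

(** With only left axioms at hand, multiply on the left by [1], written as the inverse of [lg_inv g]
    times [lg_inv g], and collapse from the inside. *)
Lemma lg_mulVr (g : G) : lg_mul g (lg_inv g) = lg_one G.
Proof.
rewrite -[LHS](lg_mul1 (l := G)) -{1}(lg_mulV (lg_inv g)) -lg_mulA.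
by rewrite [lg_mul (lg_inv g) _]lg_mulA lg_mulV lg_mul1 lg_mulV.
Qed.

Lemma lg_inv1 : lg_inv (lg_one G) = lg_one G.
Proof. by rewrite -[LHS]lg_mul1 lg_mulVr. Qed.

Lemma lg_mulr1 (g : G) : lg_mul g (lg_one G) = g.
Proof. by rewrite -(lg_mulV g) lg_mulA lg_mulVr lg_mul1. Qed.

End LieGroups.

(** * The differential of Upsilon and its effect on variations *)

Section ReducedTrajectories.
Local Open Scope ring_scope.
Context {R : realType} {G : lie_group R} {E M F : manifold R}.
Context {phi : fiber_bundle E M F} {S : dlps phi} {sym : symmetry_group G S}.
Context {A : discrete_connection (actQ sym)}.
Context {GE : quotient (conj_action (actE sym))}.
Context {p : fiber_bundle GE (actQ sym) (mprod F G)} {Sr : dlps p}.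
Hypothesis Hred : reduced_system A Sr.

Let pi := quo_proj (actQ sym).
Let Ups1 := Upsilon1 A GE.
Let Ups := Upsilon A GE.

Let pi_mdiff m : mdifferentiable pi m.
Proof. exact: smooth_mdifferentiable (pb_submersion (quo_principal _)).1. Qed.

Let phi_mdiff e : mdifferentiable phi e.
Proof. exact: smooth_mdifferentiable (fb_smooth phi). Qed.

Let Upsilon1_mdiff (x : Cprime E M) : mdifferentiable Ups1 x.
Proof.
(* The composite is assembled from the inside: [d2] is for [(phi e, m)], [d3] applies [Ad], [d4]
   pairs the result with [e], and the quotient map comes last. *)
have d1 := mdifferentiable_fst x.
have d2 := mdifferentiable_pair (mdifferentiable_comp d1 (phi_mdiff _))
  (mdifferentiable_snd x).
have d3 := mdifferentiable_comp d2 (smooth_mdifferentiable _ (Ad_smooth A)).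
have d4 := mdifferentiable_pair d1 d3.
exact: (mdifferentiable_comp d4
  (smooth_mdifferentiable _ (pb_submersion (quo_principal GE)).1)).
Qed.

Let pi_snd_mdiff (x : Cprime E M) :
  mdifferentiable (pi \o snd : Cprime E M -> actQ sym) x.
Proof. exact: mdifferentiable_comp (mdifferentiable_snd x) (pi_mdiff _). Qed.

Let Upsilon_mdiff (x : Cprime E M) : mdifferentiable Ups x.
Proof. exact: mdifferentiable_pair (Upsilon1_mdiff x) (pi_snd_mdiff x). Qed.

Lemma mdiff_Upsilon (x : Cprime E M) (v : tangent x) :
  mdiff Ups x v = (D1 Ups1 x v.1 + D2 Ups1 x v.2, mdiff pi x.2 v.2).
Proof.
rewrite -mdiff_D12 -(mdiff_snd v) -mdiff_comp //.
- exact: (mdiff_pair v (Upsilon1_mdiff x) (pi_snd_mdiff x)).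
- exact: mdifferentiable_snd.
Qed.

(** Differentiate [p \o Ups1 = pi \o phi \o fst]: the [m] component drops out. This gives the
    condition linking consecutive entries of an image variation. *)
Lemma mdiff_proj_Upsilon1 (x : Cprime E M) (v : tangent x) :
  mdiff p (Ups1 x) (D1 Ups1 x v.1 + D2 Ups1 x v.2)
  = mdiff pi (phi x.1) (mdiff phi x.1 v.1).
Proof.
have d1 := mdifferentiable_fst x.
rewrite -mdiff_D12 -mdiff_comp //; last first.
  exact: smooth_mdifferentiable (fb_smooth p).
have -> : p \o Ups1 = pi \o (phi \o fst).
  by apply/funext => y; exact: (red_proj Hred).
rewrite (mdiff_comp v (mdifferentiable_comp d1 (phi_mdiff _)) (pi_mdiff _)).
by rewrite (mdiff_comp v d1 (phi_mdiff _)) (mdiff_fst v).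
Qed.

Lemma Upsilon_path (N : nat) (u : 'I_N -> Cprime E M) :
  discrete_path phi u -> discrete_path p (Ups \o u).
Proof.
move=> hu i j ij; rewrite /Csecond /= (hu i j ij).
exact: esym (red_proj Hred _ _).
Qed.

Lemma Upsilon_variation (N : nat) (u : 'I_N -> Cprime E M)
    (du : forall k, tangent (u k)) :
  discrete_path phi u -> fixed_endpoint_variation S u du ->
  fixed_endpoint_variation Sr (Ups \o u) (fun k => mdiff Ups (u k) (du k)).
Proof.
move=> hu [du2 duN [te [teN teS te0]]]; split.
- move=> i j ij; rewrite !mdiff_Upsilon /= mdiff_proj_Upsilon1 (du2 i j ij).
  by rewrite (hu i j ij).
- by move=> i iN; rewrite mdiff_Upsilon /= duN // mdiff0.
(* The [D2] term coming from the base component of [du i] is exactly the correction term in the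
   reduced chaining map. *)
have chain (i j : 'I_N) : j = i.+1 :> nat ->
    D1 Ups1 (u i) (ivcm S (u i) (u j) (te j)) + D2 Ups1 (u i) (du i).2
    = ivcm Sr (Ups (u i)) (Ups (u j)) (D1 Ups1 (u j) (te j)).
  move=> ij; rewrite (red_ivcm Hred (hu i j ij)) (du2 i j ij).
  congr (_ + D2 _ _ _).
  (* [te j] and [du j] differ by a value of [ivcm], which is vertical *)
  have [jN|jN] := eqVneq N j.+1; first by rewrite teN.
  have jN' : (j.+1 < N)%N by rewrite ltn_neqAle eq_sym jN ltn_ord.
  have jk : Ordinal jN' = j.+1 :> nat by [].
  (* As a successor, [j] is positive, so the interior clause of the variation applies to it. *)
  rewrite (teS j (Ordinal jN')) // ?ij // mdiffD.
  by rewrite (ivcm_vertical S (hu _ _ jk)) addr0.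
exists (fun k => D1 Ups1 (u k) (te k)); split.
- by move=> i iN; rewrite mdiff_Upsilon /= duN // teN // D20 addr0.
- move=> i j ij i0; rewrite mdiff_Upsilon /= (teS i j) // D1D -addrA.
  by congr (_ + _); exact: chain.
- move=> i j i0 j1; rewrite mdiff_Upsilon /= (te0 i j) //.
  by apply: chain; rewrite i0 j1.
Qed.

Lemma Upsilon_trajectory (N : nat) (u : 'I_N -> Cprime E M) :
  discrete_path phi u -> trajectory Sr (Ups \o u) -> trajectory S u.
Proof.
move=> hu [_ tu]; split => // du hdu.
have := tu _ (Upsilon_variation hu hdu).
rewrite !dfun_discrete_action; try exact: Ld_smooth.
apply: etrans; apply: eq_bigr => k _.
have -> : Ld S = Ld Sr \o Ups by apply/funext => x; rewrite /= (red_Ld Hred).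
apply: (dfun_comp (V := R^o)) => //.
exact: smooth_fun_differentiable (Ld_smooth Sr).
Qed.

(** * Lifting points and paths through Upsilon *)

(** A representative [(e, w)] of the class can be translated by some [g] so that [e] lands over [m],
    which conjugates [w] into [w']. Translating by [w'] the point over [r] that is horizontal from
    [m] then gives connection value [w']. *)
Lemma Upsilon_lift (m : M) (y : Cprime GE (actQ sym)) :
  p y.1 = pi m -> exists2 x : Cprime E M, phi x.1 = m & Ups x = y.
Proof.
case: y => v r /=; have [[e w] <-] := pb_surjective (quo_principal GE) v.
rewrite (red_proj Hred) => /(pb_orbits (quo_principal _)) [g mE].
have [m' hm' <-] := Hor_global A m r.
pose w' := lg_mul (lg_mul g w) (lg_inv g).
exists (actE sym g e, actM sym w' m'); first by rewrite act_equivariant.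
congr (_, _).
  rewrite /Upsilon1 /=; have -> : Ad A (phi (actE sym g e)) (actM sym w' m') = w'.
    apply/esym/AdP; rewrite act_equivariant -mE -(lactM (actM_action _)).
    by rewrite lg_mulV (lact1 (actM_action _)).
  by apply/esym/(pb_orbits (quo_principal GE)); exists g.
by apply/esym/(pb_orbits (quo_principal _)); exists w'.
Qed.

(** The element [g] relating the two representatives fixes [phi e], so freeness on [M] makes it [1].
    Then [e = e'] and the connection values agree, and uniqueness of that value within an orbit
    gives [m = m']. *)
Lemma Upsilon_inj (x y : Cprime E M) :
  phi x.1 = phi y.1 -> Ups x = Ups y -> x = y.
Proof.
case: x y => [e m] [e' m'] /= ee [].
move=> /(pb_orbits (quo_principal GE)) [g [e'E wE]].
move=> /(pb_orbits (quo_principal _)) [h m'E].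
have g1 : g = lg_one G.
  by apply: (actM_free (b := sym) (x := phi e)); rewrite -act_equivariant -e'E.
subst g; move: e'E wE; rewrite (lact1 (actE_action _)) => ->.
rewrite lg_mul1 lg_inv1 lg_mulr1 => wE; congr (_, _).
set w := Ad A (phi e) m in wE.
have hm : Hor A (phi e, actM sym (lg_inv w) m) by apply/AdP.
have hm' : Hor A (phi e, actM sym (lg_inv w) m').
  by apply/AdP; rewrite -wE ee.
(* both translates lie in one orbit and in one horizontal fiber *)
pose k := lg_mul (lg_mul (lg_inv w) h) w.
have kE : actM sym (lg_inv w) m' = actM sym k (actM sym (lg_inv w) m).
  rewrite m'E -!(lactM (actM_action _)); congr (actM _ _ _).
  by rewrite /k -lg_mulA lg_mulVr lg_mulr1.
(* Both [1] and [k] satisfy the defining property of [Ad] at this pair: the translate of [m'] is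
   itself horizontal, and undoing [k] yields the horizontal translate of [m]. Hence [k = 1]. *)
have k1 : lg_one G = Ad A (phi e) (actM sym (lg_inv w) m').
  by apply/AdP; rewrite lg_inv1 (lact1 (actM_action _)).
have : k = Ad A (phi e) (actM sym (lg_inv w) m').
  apply/AdP; rewrite kE -(lactM (actM_action _)) lg_mulV.
  by rewrite (lact1 (actM_action _)).
rewrite -k1 => k1'; move: kE; rewrite k1' (lact1 (actM_action _)) => mm.
have := congr1 (actM sym w) mm.
by rewrite -!(lactM (actM_action _)) lg_mulVr !(lact1 (actM_action _)).
Qed.

Lemma path_lift (N : nat) (vr : 'I_N.+1 -> Cprime GE (actQ sym))
    (x0 : Cprime E M) :
  discrete_path p vr -> Ups x0 = vr ord0 ->
  exists u, [/\ discrete_path phi u, u ord0 = x0 & forall k, Ups (u k) = vr k].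
Proof.
move=> hvr hx0.
(* Keeping the compatibility condition inside the existential makes the one-step lift [f] a total
   function, which can be iterated. *)
have /choice [f fP] : forall xy : Cprime E M * Cprime GE (actQ sym), exists x,
    p xy.2.1 = pi xy.1.2 -> phi x.1 = xy.1.2 /\ Ups x = xy.2.
  move=> [x y]; have [xy|xy] := pselect (p y.1 = pi x.2); last by exists x.
  by have [x' ? ?] := Upsilon_lift xy; exists x'.
(* The recursion runs over [nat]; [inord] returns a default index beyond [N], and those terms are
   discarded when restricting to ordinals. *)
pose w := fix w n := if n is n'.+1 then f (w n', vr (inord n)) else x0.
have wS n : (n < N)%N -> Ups (w n) = vr (inord n) ->
    phi (w n.+1).1 = (w n).2 /\ Ups (w n.+1) = vr (inord n.+1).
  move=> nN wn; apply: fP => /=.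
  (* The precondition of [f] holds because [vr] is a path and [w n] already lies over its [n]-th
     entry. *)
  rewrite -(hvr (inord n) (inord n.+1)) -?wn //.
  by rewrite !inordK // ltnW.
have wU n : (n <= N)%N -> Ups (w n) = vr (inord n).
  elim: n => [_|n IH nN].
    by rewrite hx0; congr vr; apply/val_inj; rewrite /= inordK.
  by have [] := wS n nN (IH (ltnW nN)).
exists (fun k => w k); split => //.
  move=> i j ij; have iN : (i < N)%N by rewrite -ltnS -ij.
  by rewrite /Csecond /= ij; have [-> _] := wS i iN (wU _ (ltnW iN)).
by move=> k; rewrite wU ?inord_val // -ltnS.
Qed.

Lemma path_lift_unique (N : nat) (u u' : 'I_N.+1 -> Cprime E M) :
  discrete_path phi u -> discrete_path phi u' -> u ord0 = u' ord0 ->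
  (forall k, Ups (u k) = Ups (u' k)) -> u = u'.
Proof.
move=> hu hu' uu0 uU.
suff H n (nN : (n < N.+1)%N) : u (Ordinal nN) = u' (Ordinal nN).
  by apply/funext => -[].
elim: n nN => [|n IH] nN.
  by rewrite (_ : Ordinal nN = ord0) //; exact: val_inj.
apply: Upsilon_inj => //.
(* The path condition places each new point over the second component of its predecessor, and the
   predecessors agree by induction. *)
have <- := hu (Ordinal (ltnW nN)) (Ordinal nN) erefl.
by have <- := hu' (Ordinal (ltnW nN)) (Ordinal nN) erefl; rewrite IH.
Qed.

End ReducedTrajectories.

Theorem theorem5p17 (R : realType) (G : lie_group R) (E M F : manifold R)
    (phi : fiber_bundle E M F) (S : dlps phi) (sym : symmetry_group G S)
    (A : discrete_connection (actQ sym))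
    (GE : quotient (conj_action (actE sym)))
    (p : fiber_bundle GE (actQ sym) (mprod F G)) (Sr : dlps p)
    (Hred : reduced_system A Sr)
    (N : nat) (hN : (2 <= N)%N)
    (vr : 'I_N -> Cprime GE (actQ sym)) (Hvr : trajectory Sr vr)
    (x0 : Cprime E M)
    (Hx0 : forall i : 'I_N, i = 0 :> nat -> Upsilon A GE x0 = vr i) :
  exists! u : 'I_N -> Cprime E M,
    [/\ trajectory S u,
        forall i : 'I_N, i = 0 :> nat -> u i = x0
      & forall k : 'I_N, Upsilon A GE (u k) = vr k].
Proof.
case: N hN vr Hvr Hx0 => // N _ vr Hvr Hx0.
have [u [hu u0 uU]] := path_lift Hred Hvr.1 (Hx0 ord0 erefl).
exists u; split => [|u' [[hu' _] u'0 u'U]].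
  split => // [|i i0]; last by rewrite -u0; congr u; exact: val_inj.
  apply: (Upsilon_trajectory Hred) => //.
  by rewrite (_ : _ \o u = vr) //; exact/funext.
apply: (path_lift_unique (A := A) (GE := GE)) => // [|k].
  by rewrite u0 u'0.
by rewrite uU u'U.
Qed.
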